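(* Suppose that $(X,d)$ is a quasi-metric space and that $\mathcal{B}$ is a bornology in $X$. Then the following conditions are all equivalent: (i) $\mathcal{B}$ is uniformly quasi-metrizable with respect to $d$; (ii) $\mathcal{B}$ has a base $\{B_n:n\in\omega\}$ such that, for some $\delta\in(0;+\infty)$ and for each $n\in\omega$, the inclusion $[B_n]^\delta_d\subseteq B_{n+1}$ holds; (iii) there exists a quasi-metric $\rho$ in $X$ such that $d,\rho$ are uniformly locally identical and $\mathcal{B}$ is the collection of all $\rho$-bounded sets; (iv) there exists a $(d,\rho_u)$-uniformly continuous $(\tau(d),\tau(d^{-1}))$-characteristic function for $\mathcal{B}$.
   Context: The set theory is $\mathbf{ZF}$ (no choice). A quasi-pseudometric in $X$ is a function $d:X\times X\to[0;+\infty)$ with $d(x,x)=0$ and $d(x,y)\le d(x,z)+d(z,y)$ for all $x,y,z$; it is a quasi-metric if $d(x,y)=0$ implies $x=y$. Its conjugate is $d^{-1}(x,y)=d(y,x)$. Let $B_d(x,r)=\{y\in X:d(x,y)<r\}$ and $\tau(d)=\{V\subseteq X:\forall_{x\in V}\exists_{n\in\omega}\ B_d(x,2^{-n})\subseteq V\}$. A set $A\subseteq X$ is $d$-bounded if $A\subseteq B_d(x,r)$ for some $x\in X$, $r\in(0;+\infty)$. For $A\subseteq X$ and $\delta\in(0;+\infty)$, $[A]^\delta_d=\bigcup_{a\in A}B_d(a,\delta)$. A bornology in $X$ is a non-void ideal of subsets of $X$ (closed under subsets and finite unions) containing every singleton. A base for $\mathcal{B}$ is a collection $\mathcal{A}\subseteq\mathcal{B}$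 such that every member of $\mathcal{B}$ is a subset of a member of $\mathcal{A}$. Quasi-metrics $d_0,d_1$ in $X$ are uniformly equivalent if for every $\epsilon>0$ there are $\delta_0,\delta_1>0$ such that, for all $x,y\in X$ and $i\in\{0,1\}$, $d_i(x,y)<\delta_i$ implies $d_{1-i}(x,y)<\epsilon$. The bornology $\mathcal{B}$ is uniformly quasi-metrizable with respect to $d$ if there is a quasi-metric $\rho$ in $X$ uniformly equivalent with $d$ such that $\mathcal{B}$ is the collection of all $\rho$-bounded sets. Quasi-metrics $d,\rho$ are uniformly locally identical if they are uniformly equivalent and there is $\delta\in(0;+\infty)$ such that, for all $x,y\in X$, $d(x,y)<\delta$ implies $\rho(x,y)=d(x,y)$. On $\mathbb{R}$, $\rho_u(x,y)=\max\{y-x,0\}$ (a quasi-pseudometric). A mapping $f:X\to\mathbb{R}$ is $(d,\rho_u)$-uniformly continuous if for every $\epsilon>0$ there is $\delta>0$ such that $d(x_1,x_2)<\delta$ implies $\rho_u(f(x_1),f(x_2))<\epsilon$ for all $x_1,x_2\in X$. Let $u=\{\emptyset,\mathbb{R}\}\cup\{(-\infty;a):a\in\mathbb{R}\}$ and $l=\{\emptyset,\mathbb{R}\}\cup\{(a;+\infty):a\in\mathbb{R}\}$. For topologies $\tau_1,\tau_2$ in $X$, a $(\tau_1,\tau_2)$-characteristic function for $\mathcal{B}$ is a function $f:X\to[0;+\infty)$ that is continuous from $\tau_1$ to the trace of $u$ on $[0;+\infty)$ and from $\tau_2$ to the trace of $l$ on $[0;+\infty)$, and satisfies $\mathcal{B}=\{A\subseteq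 X:\sup\{f(x):x\in A\}<+\infty\}$. *)

(* Defs.v *)
From mathcomp Require Import all_boot all_order all_algebra.
From mathcomp Require Import all_classical all_reals all_analysis.

Set Implicit Arguments.
Unset Strict Implicit.
Unset Printing Implicit Defensive.

Import Order.TTheory GRing.Theory Num.Theory.
Local Open Scope classical_set_scope.
Local Open Scope ring_scope.

Section QuasiMetric.
Context {R : realType} {X : Type}.
Implicit Types (d rho : X -> X -> R) (A : set X).

Definition quasi_pseudometric d : Prop :=
  [/\ forall x y, 0 <= d x y,
      forall x, d x x = 0
    & forall x y z, d x y <= d x z + d z y].

Definition quasi_metric d : Prop :=
  quasi_pseudometric d /\ forall x y, d x y = 0 -> x = y.

Definition conjugate d : X -> X -> R := fun x y => d y x.

Definition qball d (x : X) (r : R) : set X := [set y | d x y < r].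

(* Topologies are given as families of open sets because
   several of them are used on the same carrier. *)
Definition qtopology d : set (set X) :=
  [set V | forall x, V x -> exists n : nat, qball d x (2 ^- n) `<=` V].

Definition qbounded d : set (set X) :=
  [set A | exists x : X, exists r : R, 0 < r /\ A `<=` qball d x r].

Definition enlargement d A (delta : R) : set X :=
  \bigcup_(a in A) qball d a delta.

Definition uniformly_equivalent d0 d1 : Prop :=
  forall eps : R, 0 < eps ->
  exists delta0 delta1 : R, [/\ 0 < delta0, 0 < delta1
    & forall x y, (d0 x y < delta0 -> d1 x y < eps) /\
                  (d1 x y < delta1 -> d0 x y < eps)].

Definition uniformly_locally_identical d rho : Prop :=
  uniformly_equivalent d rho /\
  exists delta : R, 0 < delta /\ forall x y, d x y < delta -> rho x y = d x y.

End QuasiMetric.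

Section Bornology.
Context {X : Type}.

Definition bornology (B : set (set X)) : Prop :=
  [/\ B !=set0,
      forall A C : set X, C `<=` A -> B A -> B C,
      forall A C : set X, B A -> B C -> B (A `|` C)
    & forall x : X, B [set x]].

Definition bornology_base (B A : set (set X)) : Prop :=
  A `<=` B /\ forall C, B C -> exists2 D, A D & C `<=` D.

End Bornology.

Definition uniformly_quasi_metrizable {R : realType} {X : Type}
    (d : X -> X -> R) (B : set (set X)) : Prop :=
  exists rho : X -> X -> R,
    [/\ quasi_metric rho, uniformly_equivalent d rho & B = qbounded rho].

Definition rho_u {R : realType} (x y : R) : R := Num.max (y - x) 0.

Definition q_unif_continuous {R : realType} {X Y : Type}
    (d : X -> X -> R) (rho : Y -> Y -> R) (f : X -> Y) : Prop :=
  forall eps : R, 0 < eps -> exists delta : R, 0 < delta /\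
    forall x1 x2, d x1 x2 < delta -> rho (f x1) (f x2) < eps.

Definition u_topology {R : realType} : set (set R) :=
  [set set0; setT] `|` [set V | exists a : R, V = [set x | x < a]].

Definition l_topology {R : realType} : set (set R) :=
  [set set0; setT] `|` [set V | exists a : R, V = [set x | a < x]].

Definition trace_topology {Y : Type} (tau : set (set Y)) (S : set Y) :
    set (set Y) :=
  [set U `&` S | U in tau].

Definition continuous_between {X Y : Type} (tau : set (set X))
    (sigma : set (set Y)) (f : X -> Y) : Prop :=
  forall V, sigma V -> tau (f @^-1` V).

Definition characteristic_function {R : realType} {X : Type}
    (tau1 tau2 : set (set X)) (B : set (set X)) (f : X -> R) : Prop :=
  let nonneg := [set t : R | 0 <= t] in
  [/\ forall x, 0 <= f x,
      continuous_between tau1 (trace_topology u_topology nonneg) f,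
      continuous_between tau2 (trace_topology l_topology nonneg) f
    & B = [set A | (ereal_sup [set (f x)%:E | x in A] < +oo)%E]].

(* Main.v *)
(** From a base [B_n] with [[B_n]^delta <= B_{n+1}] one builds the gauge
    [f x = inf {n delta + d a x : a in B_n, d a x < delta}].  It is bounded by
    [n delta] on [B_n] and [f x < n delta] forces [x] into [B_n], so it is bounded
    exactly on the members of the bornology; moreover [f y <= f x + 2 d x y]
    when [d x y < delta].  Hence [f] is the characteristic function of (iv), and
    [max (min d delta) ((f y - f x) / 2)] is the quasi-metric of (iii).
    Conversely, balls around a point and sublevel sets of a characteristic
    function are bases as in (ii). *)

Require Import Defs.
From mathcomp Require Import all_boot all_order all_algebra.
From mathcomp Require Import all_classical all_reals all_analysis.
From mathcomp Require Import lra.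
Import Order.TTheory GRing.Theory Num.Theory.
Local Open Scope classical_set_scope.
Local Open Scope ring_scope.

Lemma ereal_sup_image_lty (R : realType) (X : Type) (f : X -> R) (A : set X) :
  (ereal_sup [set (f x)%:E | x in A] < +oo)%E <->
  exists M : R, forall x, A x -> f x <= M.
Proof.
split=> [|[M fM]]; last first.
  apply: (@le_lt_trans _ _ M%:E); last exact: ltry.
  by apply: ge_ereal_sup => _ [x Ax <-]; rewrite lee_fin; exact: fM.
have ub x : A x -> ((f x)%:E <= ereal_sup [set (f x)%:E | x in A])%E.
  by move=> Ax; apply: ereal_sup_ubound; exists x.
case: (ereal_sup _) ub => [M||] ub //.
  by exists M => x /ub; rewrite lee_fin.
(* A supremum equal to [-oo] leaves no point in [A], so any bound serves. *)
by exists 0 => x /ub.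
Qed.

Lemma exists_expV2_lt (R : realType) (e : R) :
  0 < e -> exists n : nat, (2 : R) ^- n < e.
Proof.
move=> e0; have [n _ /(_ n (leqnn n))] := near_infty_natSinv_expn_lt (PosNum e0).
by rewrite div1r; exists n.
Qed.

Section UniformGauge.
Variables (R : realType) (X : Type) (d : X -> X -> R).
Implicit Types (f : X -> R) (B : set (set X)).

Lemma unif_continuous_rho_uP f :
  q_unif_continuous d rho_u f <->
  forall eps : R, 0 < eps -> exists delta : R, 0 < delta /\
    forall x y, d x y < delta -> f y < f x + eps.
Proof.
by split=> uf eps eps0; have [delta [delta0 fd]] := uf _ eps0;
  exists delta; split=> // x y /fd; rewrite /rho_u gt_max eps0 andbT ltrBlDl.
Qed.

Lemma unif_continuous_u f (S : set R) : (forall x, S (f x)) ->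
  q_unif_continuous d rho_u f ->
  continuous_between (qtopology d) (trace_topology u_topology S) f.
Proof.
move=> Sf /unif_continuous_rho_uP uf _ [U + <-] x [Ux Sx].
case=> [[U0|UT]|[a Ua]].
- by move: Ux; rewrite U0.
- by exists 0%N => y _; split=> //; rewrite UT.
- have fxa : f x < a by move: Ux; rewrite Ua.
  have := uf (a - f x); rewrite subr_gt0 => /(_ fxa)[delta [delta0 fd]].
  have [n ndelta] := exists_expV2_lt _ _ delta0.
  exists n => y xy; split=> //; rewrite Ua /=.
  by rewrite -(subrKC (f x) a) fd// (lt_trans xy).
Qed.

(** In a conjugate ball around [x] it is [d y x] that is small, so the one-sided estimate reads
    [f x < f y + eps] and bounds [f y] from below. *)
Lemma unif_continuous_l f (S : set R) : (forall x, S (f x)) ->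
  q_unif_continuous d rho_u f ->
  continuous_between (qtopology (conjugate d)) (trace_topology l_topology S) f.
Proof.
move=> Sf /unif_continuous_rho_uP uf _ [U + <-] x [Ux Sx].
case=> [[U0|UT]|[a Ua]].
- by move: Ux; rewrite U0.
- by exists 0%N => y _; split=> //; rewrite UT.
- have fxa : a < f x by move: Ux; rewrite Ua.
  have := uf (f x - a); rewrite subr_gt0 => /(_ fxa)[delta [delta0 fd]].
  have [n ndelta] := exists_expV2_lt _ _ delta0.
  exists n => y xy; split=> //; rewrite Ua /=.
  have := fd y x (lt_trans xy ndelta); lra.
Qed.

(** The supremum clause of [characteristic_function], stated with real bounds. *)
Definition bounding B f :=
  forall A, B A <-> exists M : R, forall x, A x -> f x <= M.

Lemma bounding_characteristic B f : (forall x, 0 <= f x) ->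
  q_unif_continuous d rho_u f -> bounding B f ->
  characteristic_function (qtopology d) (qtopology (conjugate d)) B f.
Proof.
move=> f0 uf Bf; split=> //.
- exact: unif_continuous_u.
- exact: unif_continuous_l.
- apply/seteqP; split=> A /=.
    by move=> /Bf; rewrite ereal_sup_image_lty.
  by rewrite ereal_sup_image_lty => /Bf.
Qed.

(** Uniform continuity at [eps = 1] gives one [delta] for which a step shorter than [delta] raises
    [f] by less than 1, so integer sublevel sets absorb each other's enlargements. *)
Lemma uniform_base_of_unif_continuous B f : (forall x, 0 <= f x) ->
  bounding B f -> q_unif_continuous d rho_u f ->
  exists Bn : nat -> set X, bornology_base B (range Bn) /\
    exists delta : R, 0 < delta /\
      forall n, enlargement d (Bn n) delta `<=` Bn n.+1.
Proof.
move=> f0 Bf /unif_continuous_rho_uP /(_ _ ltr01)[delta [delta0 fd]].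
exists (fun n => [set x | f x < n%:R]); split; first split.
- by move=> _ [n _ <-]; apply/Bf; exists n%:R => x /ltW.
- move=> C /Bf[M CM]; exists [set x | f x < (Num.bound `|M|)%:R].
    by exists (Num.bound `|M|).
  move=> x /CM /= /le_lt_trans; apply; apply: le_lt_trans (ler_norm M) _.
  exact: archi_boundP.
- exists delta; split=> // n y [x /= fxn /fd fyx].
  by rewrite -natr1 (lt_trans fyx)// ltrD2r.
Qed.

Lemma gauge_of_uniform_base B (Bn : nat -> set X) (delta : R) :
  quasi_pseudometric d -> bornology B -> bornology_base B (range Bn) ->
  0 < delta -> (forall n, enlargement d (Bn n) delta `<=` Bn n.+1) ->
  exists f : X -> R, [/\ forall x, 0 <= f x, bounding B f
    & forall x y, d x y < delta -> f y <= f x + 2 * d x y].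
Proof.
move=> [d0 dxx dtr] [_ Bsub _ B1] [BnB Bbase] delta0 step.
have cover x : exists n, Bn n x.
  by have [_ [n _ <-] xn] := Bbase _ (B1 x); exists n; exact: xn.
have mono m n : (m <= n)%N -> Bn m `<=` Bn n.
  move=> /subnK <-; elim: (n - m)%N => [//|k IH] x /IH xk.
  by rewrite addSn; apply: step; exists x => //; rewrite /qball /= dxx.
pose S x := [set s : R | exists n a,
  [/\ Bn n a, d a x < delta & s = n%:R * delta + d a x]].
have S0 x : lbound (S x) 0.
  by move=> _ [n [a [_ _ ->]]]; rewrite addr_ge0// mulr_ge0// ltW.
have SBn n x : Bn n x -> S x (n%:R * delta).
  by move=> xn; exists n, x; rewrite dxx addr0.
have Sn x : S x !=set0.
  by have [n /SBn ?] := cover x; exists (n%:R * delta).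
have infS x s : S x s -> inf (S x) <= s.
  by move=> xs; apply: ge_inf => //; exists 0; exact: S0.
have leBn n x : Bn n x -> inf (S x) <= n%:R * delta.
  by move=> /SBn; exact: infS.
have ltBn n x : inf (S x) < n%:R * delta -> Bn n x.
  move=> xn; have [_ [k [a [ak ax ->]]]] : exists2 s, S x s &
      s < inf (S x) + (n%:R * delta - inf (S x)).
    apply: inf_adherent; first by rewrite subr_gt0.
    by split=> //; exists 0; exact: S0.
  rewrite subrKC => lt_n.
  (* Since [k * delta <= s < n * delta], level [k] lies strictly below [n], which leaves room for
     the one enlargement needed to reach [x] from [a]. *)
  have kn : (k < n)%N.
    rewrite -(ltr_nat R) -(ltr_pM2r delta0); apply: le_lt_trans lt_n.
    by rewrite lerDl.
  by apply: (mono _ _ kn); apply: step; exists a.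
exists (fun x => inf (S x)); split.
- by move=> x; apply: lb_le_inf => //; exact: S0.
- move=> A; split=> [/Bbase[_ [n _ <-] An]|[M AM]].
    by exists (n%:R * delta) => x /An; exact: leBn.
  pose n := Num.bound (`|M| / delta).
  apply: (Bsub (Bn n)); last by apply: BnB; exists n.
  move=> x /AM xM; apply: ltBn; apply: (le_lt_trans xM).
  apply: le_lt_trans (ler_norm M) _; rewrite -ltr_pdivrMr//.
  by apply: archi_boundP; rewrite divr_ge0// ltW.
(* The factor 2 comes from the second case: one [d x y] is the new last jump, the other helps pay
   for the extra level. *)
- move=> x y xy; rewrite -lerBlDr; apply: lb_le_inf => // _ [n [a [an ax ->]]].
  have xy0 := d0 x y; have ay := dtr a y x.
  have [axy|axy] := ltP (d a y) delta.
    have : inf (S y) <= n%:R * delta + d a y by apply: infS; exists n, a.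
    lra.
  (* Here [x] itself is the better witness: it lies in [B_{n+1}], and
     [delta <= d a y <= d a x + d x y]. *)
  have : inf (S y) <= n.+1%:R * delta + d x y.
    by apply: infS; exists n.+1, x; split=> //; apply: step; exists a.
  rewrite -natr1 mulrDl mul1r; lra.
Qed.

Lemma gauge_unif_continuous f (delta : R) : 0 < delta ->
  (forall x y, d x y < delta -> f y <= f x + 2 * d x y) ->
  q_unif_continuous d rho_u f.
Proof.
move=> delta0 fd; apply/unif_continuous_rho_uP => eps eps0.
exists (Num.min delta (eps / 2)); split.
  by rewrite lt_min delta0 divr_gt0.
by move=> x y; rewrite lt_min => /andP[/fd fxy xy]; lra.
Qed.

(** Halving the increment of [f] keeps it below [d x y] at distances under [delta], so there [rho]
    is [d]. Truncating [d] at [delta] leaves [f] alone to decide which sets are bounded. *)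
Lemma gauge_quasi_metric B f (delta : R) : inhabited X -> quasi_metric d ->
  0 < delta -> (forall x, 0 <= f x) -> bounding B f ->
  (forall x y, d x y < delta -> f y <= f x + 2 * d x y) ->
  exists rho : X -> X -> R,
    [/\ quasi_metric rho, uniformly_locally_identical d rho & B = qbounded rho].
Proof.
move=> [x0] [[d0 dxx dtr] deq] delta0 f0 Bf fd.
pose rho x y := Num.max (Num.min (d x y) delta) ((f y - f x) / 2).
have rhod x y : d x y < delta -> rho x y = d x y.
  move=> xy; rewrite /rho (min_l (ltW xy)); apply: max_l.
  by have := fd _ _ xy; lra.
have drho x y : Num.min (d x y) delta <= rho x y by rewrite le_max lexx.
have frho x y : (f y - f x) / 2 <= rho x y by rewrite le_max lexx orbT.
have rho0 x y : 0 <= rho x y.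
  by apply: le_trans (drho x y); rewrite le_min d0 ltW.
have lt_rho x y e : e <= delta -> rho x y < e -> d x y < e.
  move=> edelta /(le_lt_trans (drho x y)); rewrite gt_min => /orP[//|].
  by rewrite ltNge edelta.
exists rho; split.
- split; first split=> //.
  + by move=> x; rewrite rhod dxx.
  + move=> x y z; rewrite {1}/rho ge_max; apply/andP; split; last first.
      by have := frho x z; have := frho z y; lra.
    apply: le_trans (lerD (drho x z) (drho z y)).
    have := dtr x y z; have := d0 x z; have := d0 z y; rewrite ge_min.
    (* If either leg exceeds [delta], the right side is at least [delta]; otherwise the triangle
       inequality of [d] applies. *)
    have [xz|xz] := leP (d x z) delta; have [zy|zy] := leP (d z y) delta => *;
      apply/orP; (left; lra) || (right; lra).
  + move=> x y xy; apply: deq; rewrite -rhod//; apply: lt_rho => //.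
    by rewrite xy.
- split; last by exists delta.
  move=> eps eps0; exists (Num.min delta eps), (Num.min delta eps).
  have m0 : 0 < Num.min delta eps by rewrite lt_min delta0.
  split=> // x y; split=> [|xy].
    by rewrite lt_min => /andP[xy ?]; rewrite rhod.
  have : d x y < Num.min delta eps by apply: lt_rho => //; rewrite ge_min lexx.
  by rewrite lt_min => /andP[].
- apply/seteqP; split=> A.
    move=> /Bf[M AM]; exists x0, (delta + `|M| + 1); split.
      by have := normr_ge0 M; lra.
    move=> x /AM xM; rewrite /qball /= gt_max gt_min.
    have := ler_norm M; have := f0 x0; have := normr_ge0 M => *.
    by apply/andP; split; [apply/orP; right|]; lra.
  move=> [x [r [r0 Ar]]]; apply/Bf; exists (f x + 2 * r) => y /Ar.
  by rewrite /qball /= => xy; have := frho x y; lra.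
Qed.

(** The function [rho x0] is bounded exactly on the [rho]-bounded sets, and its growth from [x] to
    [y] is at most [rho x y], which uniform equivalence controls by [d x y]. *)
Lemma uniform_base_of_metrizable B : inhabited X ->
  uniformly_quasi_metrizable d B ->
  exists Bn : nat -> set X, bornology_base B (range Bn) /\
    exists delta : R, 0 < delta /\
      forall n, enlargement d (Bn n) delta `<=` Bn n.+1.
Proof.
move=> [x0] [rho [[[rho0 rhoxx rhotr] _] drho ->]].
apply: (@uniform_base_of_unif_continuous _ (rho x0)) => //.
- move=> A; split=> [[x [r [r0 Ar]]]|[M AM]].
    exists (rho x0 x + r) => y /Ar; rewrite /qball /= => xy.
    by have := rhotr x0 y x; lra.
  exists x0, (`|M| + 1); split; first by have := normr_ge0 M; lra.
  by move=> x /AM; rewrite /qball /=; have := ler_norm M; lra.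
- apply/unif_continuous_rho_uP => eps /drho[delta [delta1 [delta0 _ dr]]].
  exists delta; split=> // x y /(dr x y).1 xy.
  by have := rhotr x0 y x; lra.
Qed.

End UniformGauge.

Theorem theorem6p5 (R : realType) (X : Type) (hX : inhabited X)
    (d : X -> X -> R) (hd : quasi_metric d)
    (B : set (set X)) (hB : bornology B) :
  let i := uniformly_quasi_metrizable d B in
  let ii := exists Bn : nat -> set X,
      bornology_base B (range Bn) /\
      exists delta : R, 0 < delta /\
        forall n, enlargement d (Bn n) delta `<=` Bn n.+1 in
  let iii := exists rho : X -> X -> R,
      [/\ quasi_metric rho, uniformly_locally_identical d rho
        & B = qbounded rho] in
  let iv := exists f : X -> R,
      q_unif_continuous d rho_u f /\
      characteristic_function (qtopology d) (qtopology (conjugate d)) B f in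
  [/\ i <-> ii, i <-> iii & i <-> iv].
Proof.
move=> i ii iii iv.
(* Two cycles through [ii] suffice: [i -> ii -> iii -> i] and [ii -> iv -> ii]. *)
have i_ii : i -> ii by exact: uniform_base_of_metrizable.
have ii_iii : ii -> iii.
  move=> [Bn [base [delta [delta0 step]]]].
  have [f [f0 Bf fd]] :=
    gauge_of_uniform_base _ _ _ _ _ _ hd.1 hB base delta0 step.
  exact: gauge_quasi_metric fd.
have ii_iv : ii -> iv.
  move=> [Bn [base [delta [delta0 step]]]].
  have [f [f0 Bf fd]] :=
    gauge_of_uniform_base _ _ _ _ _ _ hd.1 hB base delta0 step.
  have uf := gauge_unif_continuous _ _ _ _ _ delta0 fd.
  by exists f; split=> //; exact: bounding_characteristic.
have iii_i : iii -> i by move=> [rho [qrho [drho _] Brho]]; exists rho.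
have iv_ii : iv -> ii.
  move=> [f [uf [f0 _ _ Bf]]].
  apply: uniform_base_of_unif_continuous uf => // A.
  by rewrite Bf -ereal_sup_image_lty.
by split; split; auto.
Qed.
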